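(* $t(1)=2$.
   Context: Let $\mathfrak{C}=\{0,1\}^n$ be the vertex set of the $n$-dimensional hypercube; $\oplus,\wedge$ denote bitwise XOR and AND. An outmap is any function $s:\mathfrak{C}\to\{0,1\}^n$. A clash of $s$ is a pair of distinct vertices $u,v$ with $(s(u)\oplus s(v))\wedge(u\oplus v)=0^n$. A query at $u$ to the oracle for $s$ returns $s(u)$; algorithms choose queries adaptively, and only the number of queries is counted. \textsc{Sink-or-Clash}: given oracle access to an arbitrary outmap $s$, query either a vertex $u$ with $s(u)=0^n$ or both vertices of some clash. $t(n)=\min_{\mathcal A}\max_s t(\mathcal A,s)$, where $\mathcal A$ ranges over deterministic algorithms solving \textsc{Sink-or-Clash} on all outmaps of the $n$-cube and $t(\mathcal A,s)$ is the number of queries made on $s$. *)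

(* Defs.v *)
From mathcomp Require Import all_boot.
From mathcomp Require Import boolp.

Set Implicit Arguments.
Unset Strict Implicit.
Unset Printing Implicit Defensive.

Notation cube n := {ffun 'I_n -> bool}.

Definition bxor (n : nat) (u v : cube n) : cube n := [ffun i => u i (+) v i].
Definition band (n : nat) (u v : cube n) : cube n := [ffun i => u i && v i].
Definition zero (n : nat) : cube n := [ffun=> false].

Notation outmap n := {ffun cube n -> cube n}.

Definition is_clash (n : nat) (s : outmap n) (u v : cube n) : bool :=
  (u != v) && (band (bxor (s u) (s v)) (bxor u v) == zero n).

(* A deterministic adaptive query algorithm is a decision tree.  Every branch
   of an inductive tree is finite, so an algorithm stops on every outmap. *)
Inductive algorithm (n : nat) : Type :=
| Stop
| Query (u : cube n) (next : cube n -> algorithm n).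

Arguments Stop {n}.

Fixpoint queries (n : nat) (A : algorithm n) (s : outmap n) : seq (cube n) :=
  match A with
  | Stop => [::]
  | Query u next => u :: queries (next (s u)) s
  end.

Definition solves_on (n : nat) (A : algorithm n) (s : outmap n) : Prop :=
  (exists2 u, u \in queries A s & s u = zero n) \/
  (exists u v, [/\ u \in queries A s, v \in queries A s & is_clash s u v]).

Definition solves_sink_or_clash (n : nat) (A : algorithm n) : Prop :=
  forall s : outmap n, solves_on A s.

(* A repeated query is counted each time it is made. *)
Definition cost (n : nat) (A : algorithm n) (s : outmap n) : nat :=
  size (queries A s).

Definition worst_cost (n : nat) (A : algorithm n) : nat :=
  \max_(s : outmap n) cost A s.

Definition achievable (n k : nat) : Prop :=
  exists2 A : algorithm n, solves_sink_or_clash A & worst_cost A = k.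

(* An outmap without a clash is injective, hence surjective, so it has a sink:
   querying every vertex always solves the problem. *)
Lemma achievable_ex (n : nat) : exists k, `[< achievable n k >].
Proof.
pose A := foldr (fun u B => Query u (fun=> B)) (@Stop n) (enum {: cube n}).
have qA s : queries A s = enum {: cube n}.
  by rewrite /A; elim: (enum _) => //= u l ->.
exists (worst_cost A); apply/asboolP; exists A => // s.
have [/existsP[u /existsP[v uv]]|noclash] :=
  boolP [exists u, exists v, is_clash s u v].
  by right; exists u, v; rewrite !qA !mem_enum.
have s_inj : injective s.
  move=> u v suv; apply/eqP; apply: contraNT noclash => neq_uv.
  apply/existsP; exists u; apply/existsP; exists v.
  by rewrite /is_clash neq_uv suv; apply/eqP/ffunP => i; rewrite !ffunE addbb.
left; exists (invF s_inj (zero n)); first by rewrite qA mem_enum.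
exact: f_invF.
Qed.

Definition t (n : nat) : nat := ex_minn (achievable_ex n).

(* Main.v *)
Require Import Defs.
From mathcomp Require Import all_boot.
From mathcomp Require Import boolp.

Set Implicit Arguments.
Unset Strict Implicit.
Unset Printing Implicit Defensive.

(** One query cannot settle an outmap without a sink, and a constant nonzero outmap is one
    ([t_gt1]). Conversely, the 1-cube has two vertices and two possible outputs: if neither vertex
    is a sink, both outputs are [ones 1], hence equal, and the vertices clash ([t1_le2]). *)

Definition ones (n : nat) : cube n := [ffun=> true].

Lemma ones_neq0 (n : nat) : 0 < n -> ones n <> zero n.
Proof. by move=> n_gt0 /ffunP/(_ (Ordinal n_gt0)); rewrite !ffunE. Qed.

Lemma cube1P (u : cube 1) : u = zero 1 \/ u = ones 1.
Proof.
by case u0: (u ord0); [right | left]; apply/ffunP => i; rewrite ord1 ffunE.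
Qed.

Lemma leq_cost_worst (n : nat) (A : algorithm n) (s : outmap n) :
  cost A s <= worst_cost A.
Proof. exact: (leq_bigmax s). Qed.

(* A constant nonzero outmap has no sink, so it can only be solved by a clash,
   which takes two distinct queries. *)
Lemma t_gt1 (n : nat) : 0 < n -> 1 < t n.
Proof.
move=> n_gt0; rewrite /t; case: ex_minnP => k /asboolP[A solvesA <-] _.
pose s : outmap n := [ffun=> ones n].
apply: leq_trans (leq_cost_worst A s).
have [[u _]|[u [v [uA vA /andP[neq_uv _]]]]] := solvesA s.
  by rewrite ffunE => /(ones_neq0 n_gt0).
apply: (@uniq_leq_size _ [:: u; v]); first by rewrite /= inE neq_uv.
by move=> w; rewrite !inE => /orP[] /eqP->.
Qed.

Lemma t1_le2 : t 1 <= 2.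
Proof.
rewrite /t; case: ex_minnP => k _; apply; apply/asboolP.
exists (Query (zero 1) (fun=> Query (ones 1) (fun=> Stop))); last first.
  (* The worst cost must be exactly 2. The tree ignores the answers, so any outmap witnesses the
     lower bound; the constant zero one is an arbitrary choice. *)
  apply/eqP; rewrite eqn_leq (leq_trans _ (leq_cost_worst _ [ffun=> zero 1])) //.
  by rewrite andbT; apply/bigmax_leqP.
move=> s.
have [s0|s0] := cube1P (s (zero 1)).
  by left; exists (zero 1); rewrite // !inE eqxx.
have [s1|s1] := cube1P (s (ones 1)).
  by left; exists (ones 1); rewrite // !inE eqxx orbT.
right; exists (zero 1), (ones 1); split; rewrite ?inE ?eqxx ?orbT //.
apply/andP; split; first by apply/eqP => /esym; apply: ones_neq0.
by apply/eqP/ffunP => i; rewrite s0 s1 !ffunE.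
Qed.

Theorem lemma22 : t 1 = 2.
Proof. by apply/eqP; rewrite eqn_leq t1_le2 t_gt1. Qed.
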